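(* Let $n\ge 3$. There is a constant $C_n>0$ depending only on $n$ such that for every orthogonally invariant measure $\mu$ on $SL(n,\mathbb{R})$ with $\log\|X\|\in L^1(\mu)$, $$\int_{SL(n,\mathbb{R})}\log\rho(X)\,d\mu(X)\ \ge\ C_n\int_{SL(n,\mathbb{R})}\log\|X\|\,d\mu(X).$$ Likewise, there is a constant $C_n'>0$ depending only on $n$ such that for every unitarily invariant measure $\mu$ on $SL(n,\mathbb{C})$ with $\log\|X\|\in L^1(\mu)$, $$\int_{SL(n,\mathbb{C})}\log\rho(X)\,d\mu(X)\ \ge\ C_n'\int_{SL(n,\mathbb{C})}\log\|X\|\,d\mu(X).$$
   Context: Measures are positive Borel measures. $\mu$ on $SL(n,\mathbb{R})$ is orthogonally invariant if it is invariant under multiplication: for each fixed $U$ in the orthogonal group with $\det U=1$, and more generally in the averaging sense for $O_n$ described next, precisely, for every Borel function $f\ge 0$ on $GL(n,\mathbb{R})$ and every $U\in SO(n)$, $\int f(XU)\,d\mu(X)=\int f(X)\,d\mu(X)$, where $\mu$ is regarded as a measure on matrices; if invariance under all of $O_n$ is required, $\mu$ is regarded as a measure on the matrices of determinant $\pm1$. Here the condition used is invariance under right multiplication by special orthogonal matrices, since multiplication by a matrix of determinant $-1$ does not preserve $SL(n,\mathbb{R})$. Similarly, $\mu$ on $SL(n,\mathbb{C})$ is unitarily invariant if it is invariant under $X\mapsto XU$ for all $U\in SU(n)$. $\rho(X)$ is the spectral radius (maximal absolute value of a complex eigenvalue), and $\|X\|$ is the operator norm with respect to the Euclidean (Hermitian)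 norm, i.e. the largest singular value. *)

(* Defs.v *)
From mathcomp Require Import all_boot all_order all_algebra.
From mathcomp Require Import all_classical all_reals all_analysis.
From mathcomp Require Import complex.

Set Implicit Arguments.
Unset Strict Implicit.
Unset Printing Implicit Defensive.

Import Order.TTheory GRing.Theory Num.Theory.
Import numFieldNormedType.Exports.

Local Open Scope classical_set_scope.
Local Open Scope complex_scope.
Local Open Scope ring_scope.

(* K is always given as a structure (and not as a carrier type), so that the
   topology on 'M[K]_n is the one induced by the absolute value of K, also when
   K is R[i], whose carrier [complex R] has no canonical topology. *)
Definition mx_open (K : numFieldType) (n : nat) : set (set 'M[K]_n) :=
  @open 'M[K]_n.
Arguments mx_open : clear implicits.

Notation borel_mx K n := (g_sigma_algebraType (mx_open K n)).

Definition GL (K : numFieldType) (n : nat) : set (borel_mx K n) :=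
  [set X : 'M[K]_n | X \in unitmx].
Arguments GL : clear implicits.

Definition SL (K : numFieldType) (n : nat) : set (borel_mx K n) :=
  [set X : 'M[K]_n | \det X = 1].
Arguments SL : clear implicits.

Definition SO (R : realType) (n : nat) : set 'M[R]_n :=
  [set U | U *m U^T = 1%:M /\ \det U = 1].
Arguments SO : clear implicits.

Definition SU (R : realType) (n : nat) : set 'M[R[i]]_n :=
  [set U | U \is unitarymx /\ \det U = 1].
Arguments SU : clear implicits.

(* A Borel measure on the closed set SL(n, K) is represented by its extension by
   zero to the space of all n x n matrices. *)
Definition measure_on_SL (R : realType) (K : numFieldType) (n : nat)
    (mu : {measure set (borel_mx K n) -> \bar R}) : Prop :=
  mu (~` SL K n) = 0%E.

Definition right_invariant (R : realType) (K : numFieldType) (n : nat)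
    (G : set 'M[K]_n) (mu : {measure set (borel_mx K n) -> \bar R}) : Prop :=
  forall (f : borel_mx K n -> R) (U : 'M[K]_n),
    measurable_fun (GL K n) f -> (forall X, GL K n X -> 0 <= f X) -> G U ->
    (\int[mu]_(X in GL K n) (f ((X : 'M[K]_n) *m U))%:E =
     \int[mu]_(X in GL K n) (f X)%:E)%E.

Definition orthogonally_invariant (R : realType) (n : nat)
    (mu : {measure set (borel_mx R n) -> \bar R}) : Prop :=
  right_invariant (SO R n) mu.

Definition unitarily_invariant (R : realType) (n : nat)
    (mu : {measure set (borel_mx R[i] n) -> \bar R}) : Prop :=
  right_invariant (SU R n) mu.

(* The modulus as an element of R: the library's `|z| is an element of R[i]. *)
Definition cabs (R : realType) (z : R[i]) : R := complex.Re `|z|.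

(* The library's norm on matrices is the maximum norm; [l2norm] and [opnorm] are
   the Euclidean (Hermitian) norm and its operator norm. The absolute value of K
   is passed as a function [abs] with values in R. *)
Definition l2norm (R : realType) (K : numFieldType) (abs : K -> R) (n : nat)
    (v : 'cV[K]_n) : R :=
  Num.sqrt (\sum_(i < n) abs (v i 0) ^+ 2).

Definition opnorm (R : realType) (K : numFieldType) (abs : K -> R) (n : nat)
    (X : 'M[K]_n) : R :=
  sup [set l2norm abs (X *m v) | v in [set v | l2norm abs v = 1]].

Definition opnormR (R : realType) (n : nat) (X : 'M[R]_n) : R :=
  opnorm (fun x : R => `|x|) X.

Definition opnormC (R : realType) (n : nat) (X : 'M[R[i]]_n) : R :=
  opnorm (@cabs R) X.

Definition spectral_radiusC (R : realType) (n : nat) (X : 'M[R[i]]_n) : R :=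
  sup [set cabs z | z in [set z | eigenvalue X z]].

Definition spectral_radiusR (R : realType) (n : nat) (X : 'M[R]_n) : R :=
  spectral_radiusC (map_mx (real_complex R) X).

(* Main.v *)
Require Import Defs.
From mathcomp Require Import all_boot all_order all_algebra.
From mathcomp Require Import all_classical all_reals all_analysis.
From mathcomp Require Import complex.
From mathcomp Require Import perm measurable_realfun ring lra.
Import Order.TTheory GRing.Theory Num.Theory.
Import numFieldNormedType.Exports.

Set Implicit Arguments.
Unset Strict Implicit.
Unset Printing Implicit Defensive.

Local Open Scope classical_set_scope.
Local Open Scope complex_scope.
Local Open Scope sesquilinear_scope.
Local Open Scope ring_scope.

(** Write Y^* for the conjugate transpose. The quantity that is compared with
both sides is

  g(Y) = | tr (adj Y) - conj (tr Y) |      ([unimodularity_defect]).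

Upper bound of g by the spectral radius. Let det Y = 1, with eigenvalues l_i,
so that adj Y = Y^-1 and g(Y) = |sum_i (1/l_i - conj l_i)|. Each summand has
modulus |1/|l_i| - |l_i||, which vanishes exactly when l_i is unimodular. Since
the product of the l_i is 1, both |l_i| and 1/|l_i| are at most rho^(n-1), where
rho is the spectral radius, hence g(Y) <= n (rho^(2(n-1)) - 1) ([defect_le]).
In other words
log rho(Y) >= h(Y), where h = log (1 + g/n) / (2(n-1)) ([log_minorant]).

Lower bound of g by the norm. Let det X = 1 and D = X^-1 - X^*. For a rotation U
one has g(XU) = |tr (U^T D)| ([trace_defect]). When n >= 3 there is a finite
family of rotations U_j, not depending on X, that spans all n x n matrices
([rotations_span]), so every entry of D is at most d = sum_j g(X U_j) in
modulus. (In dimension 2 the rotations span only a plane, and the real statement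
fails.) For a unit vector v, pairing v with D X v gives 1 - |Xv|^2, whence
|Xv|^2 - 1 <= n^2 d |Xv| and |Xv| <= 1 + n^2 d ([norm_bound]). Bernoulli's
inequality bounds 1 + n^2 sum_j g(X U_j) by the n^3-rd power of
prod_j (1 + g(X U_j)/n), so that
log ||X|| <= c sum_j h(X U_j) with c depending only on n ([ln_opnormC_le]).

Integration. Since h is continuous and nonnegative, invariance of the measure
gives the same integral to each X |-> h(X U_j), and the two bounds combine into
  int log ||X|| <= c sum_j int h(X U_j) = c #|J| int h <= c #|J| int log rho
([integral_comparison]). The function h stands between the two logarithms
because invariance is a statement about nonnegative measurable functions on all
invertible matrices, where log rho can be negative. Real matrices are treated as
complex ones throughout. *)

(** * The modulus of a complex number *)

Section cabs.
Variable R : realType.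
Implicit Types z w : R[i].

Lemma cabsE z : (cabs z)%:C = `|z|.
Proof. by rewrite /cabs normc_def. Qed.

Lemma cabs_le z (r : R) : (cabs z <= r) = (`|z| <= r%:C).
Proof. by rewrite -cabsE lecR. Qed.

Lemma cabs_ge0 z : 0 <= cabs z.
Proof. by rewrite -lecR cabsE normr_ge0. Qed.

Lemma cabsM z w : cabs (z * w) = cabs z * cabs w.
Proof. by apply: complexI; rewrite rmorphM /= !cabsE normrM. Qed.

Lemma cabsN z : cabs (- z) = cabs z.
Proof. by rewrite /cabs normrN. Qed.

Lemma cabsV z : cabs z^-1 = (cabs z)^-1.
Proof. by apply: complexI; rewrite fmorphV /= !cabsE normfV. Qed.

Lemma cabs1 : cabs (1 : R[i]) = 1.
Proof. by rewrite /cabs normr1. Qed.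

Lemma cabs_real (x : R) : cabs x%:C = `|x|.
Proof. by apply: complexI; rewrite cabsE normc_def /= expr0n addr0 sqrtr_sqr. Qed.

Lemma cabsJ z : cabs (Num.conj z) = cabs z.
Proof. by rewrite /cabs norm_conjC. Qed.

Lemma cabsD z w : cabs (z + w) <= cabs z + cabs w.
Proof. by rewrite cabs_le rmorphD /= !cabsE ler_normD. Qed.

Lemma cabs_sum (I : Type) (r : seq I) (P : pred I) (F : I -> R[i]) :
  cabs (\sum_(i <- r | P i) F i) <= \sum_(i <- r | P i) cabs (F i).
Proof.
by rewrite cabs_le rmorph_sum /= [leRHS](eq_bigr (fun i => `|F i|)) ?ler_norm_sum.
Qed.

Lemma cabs_prod (I : Type) (r : seq I) (P : pred I) (F : I -> R[i]) :
  cabs (\prod_(i <- r | P i) F i) = \prod_(i <- r | P i) cabs (F i).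
Proof. exact: (big_morph _ cabsM cabs1). Qed.

Lemma conj_real (x : R) : Num.conj x%:C = x%:C.
Proof. by rewrite conj_Creal //; apply/complex_realP; exists x. Qed.

Lemma cabs_sqr z : ((cabs z) ^+ 2)%:C = Num.conj z * z.
Proof. by rewrite rmorphXn /= cabsE normCK mulrC. Qed.

End cabs.

(** * Eigenvalues of matrices of determinant one *)

Lemma trig_mul_diag (F : comNzRingType) n (A B : 'M[F]_n) (i : 'I_n) :
  is_trig_mx A -> is_trig_mx B -> (A *m B) i i = A i i * B i i.
Proof.
move=> /is_trig_mxP tA /is_trig_mxP tB.
rewrite mxE (bigD1 i) //= big1 ?addr0 // => k ki.
have [lt_ki|lt_ik|eq_ki] := ltngtP k i.
- by rewrite tB // mulr0.
- by rewrite tA // mul0r.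
- by move: ki; rewrite -val_eqE /= eq_ki eqxx.
Qed.

Lemma eigenvalue_intertwined (F : fieldType) n (P A B : 'M[F]_n) z :
  P \in unitmx -> P *m A = B *m P -> eigenvalue B z -> eigenvalue A z.
Proof.
move=> uP PAB /eigenvalueP[v vB v0]; apply/eigenvalueP; exists (v *m P).
  by rewrite -mulmxA PAB mulmxA vB -scalemxAl.
by apply: contra v0 => /eqP vP; rewrite -(mulmxK uP v) vP mul0mx.
Qed.

Lemma adj_det1 (F : comUnitRingType) m (Y : 'M[F]_m) :
  \det Y = 1 -> \adj Y = invmx Y.
Proof. by move=> dY; rewrite /invmx unitmxE dY unitr1 invr1 scale1r. Qed.

Lemma dist_inv_le (R : realType) (r a : R) :
  0 < r -> r <= a -> r^-1 <= a -> `|r^-1 - r| <= a ^+ 2 - 1.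
Proof.
move=> r0 ra va.
have aux (x : R) : 1 <= x -> x <= a -> x - x^-1 <= a ^+ 2 - 1.
  move=> x1 xa; have x0 : 0 < x by lra.
  have : x - x^-1 <= x ^+ 2 - 1.
    rewrite -(ler_pM2l x0) mulrBr mulfV ?gt_eqF // -subr_ge0.
    have -> : x * (x ^+ 2 - 1) - (x * x - 1) = (x - 1) ^+ 2 * (x + 1) by ring.
    by rewrite mulr_ge0 ?sqr_ge0 //; lra.
  move=> /le_trans; apply; rewrite lerB // ler_sqr ?nnegrE; lra.
have [r1|r1] := leP 1 r.
  rewrite ler0_norm ?opprB; first exact: aux.
  by rewrite subr_le0 (le_trans _ r1) // invf_le1.
have v1 : 1 <= r^-1 by rewrite invf_ge1 // ltW.
rewrite ger0_norm; last by rewrite subr_ge0 (le_trans (ltW r1)).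
by rewrite -[X in _ - X]invrK; exact: aux.
Qed.

(** The cofactor matrix stands for the inverse so that the defect is defined and
continuous on all matrices; the two agree when the determinant is one. *)
Definition unimodularity_defect (R : realType) n (Y : 'M[R[i]]_n) : R :=
  cabs (\tr (\adj Y) - Num.conj (\tr Y)).

Section spectral.
Variables (R : realType) (n : nat).
Hypothesis n_gt1 : (1 < n)%N.
Implicit Type Y : 'M[R[i]]_n.

(** Y and its inverse commute, hence are triangular in a common basis, where
their diagonals are inverse to each other entry by entry. *)
Lemma eigenvalues_det1 Y : \det Y = 1 -> exists l : 'I_n -> R[i],
  [/\ \prod_i l i = 1, \tr Y = \sum_i l i, \tr (\adj Y) = \sum_i (l i)^-1
    & forall z, eigenvalue Y z <-> exists i, z = l i].
Proof.
move=> dY; have uY : Y \in unitmx by rewrite unitmxE dY unitr1.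
have cYV : Y *m \adj Y = \adj Y *m Y.
  by rewrite (adj_det1 dY) mulmxV ?mulVmx.
have [P /unitarymx_unit uP] := cotrigonalization2 cYV.
rewrite /similar_to /= !conjumx // => /andP[tT tB].
set T := P *m Y *m invmx P in tT; set B := _ *m _ *m _ in tB.
have TB : T *m B = 1%:M.
  rewrite /T /B !mulmxA mulmxKV // -(mulmxA P Y) (adj_det1 dY) mulmxV //.
  by rewrite mulmx1 mulmxV.
have TBi i : T i i * B i i = 1 by rewrite -(trig_mul_diag i tT tB) TB mxE eqxx.
have trP (Z : 'M[R[i]]_n) : \tr (P *m Z *m invmx P) = \tr Z.
  by rewrite mxtrace_mulC mulmxA mulVmx // mul1mx.
have detT : \det T = 1.
  by rewrite /T !det_mulmx dY mulr1 -det_mulmx mulmxV // det1.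
have PYT : P *m Y = T *m P by rewrite mulmxKV.
exists (fun i => T i i); split.
- by rewrite -det_trig.
- by rewrite -trP.
- rewrite -trP; apply: eq_bigr => i _; rewrite -/B.
  have Ti0 : T i i != 0.
    apply/eqP => Ti0; move: (TBi i); rewrite Ti0 mul0r => /esym/eqP.
    by rewrite oner_eq0.
  by apply: (mulfI Ti0); rewrite TBi mulfV.
- move=> z; have -> : eigenvalue Y z = eigenvalue T z.
    apply/idP/idP; last exact: eigenvalue_intertwined PYT.
    apply: (@eigenvalue_intertwined _ _ (invmx P)); rewrite ?unitmx_inv //.
    by rewrite /T !mulmxA mulVmx // mul1mx.
  rewrite eigenvalue_root_char (char_poly_trig tT) /root horner_prod.
  split=> [/prodf_eq0[i _]|[i ->]].
    by rewrite hornerXsubC subr_eq0 => /eqP ->; exists i.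
  by apply/prodf_eq0; exists i => //; rewrite hornerXsubC subrr.
Qed.

(** As the eigenvalues have product one, each modulus and its inverse are at most
a = rho^(n-1), so each eigenvalue contributes at most a^2 - 1 to the defect. *)
Lemma defect_le Y : \det Y = 1 -> 1 <= spectral_radiusC Y /\
  unimodularity_defect Y <= n%:R * (spectral_radiusC Y ^+ (2 * n.-1) - 1).
Proof.
move=> dY; have [l [prodl trl trVl specl]] := eigenvalues_det1 dY.
set rho := spectral_radiusC Y.
have rl i : cabs (l i) <= rho.
  apply: sup_upper_bound; last by exists (l i) => //; apply/specl; exists i.
  split; first by exists (cabs (l i)), (l i) => //; apply/specl; exists i.
  exists (\sum_i cabs (l i)) => _ [z /specl[j ->] <-].
  by rewrite (bigD1 j) //= lerDl sumr_ge0 // => k _; exact: cabs_ge0.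
have prodr : \prod_i cabs (l i) = 1 by rewrite -cabs_prod prodl cabs1.
have l0 i : 0 < cabs (l i).
  rewrite lt_def cabs_ge0 andbT; apply/eqP => li0.
  by move: prodr; rewrite (bigD1 i) //= li0 mul0r => /esym/eqP; rewrite oner_eq0.
have rho1 : 1 <= rho.
  have rho0 : 0 <= rho.
    by apply: le_trans (rl (Ordinal (ltnW n_gt1))); exact: cabs_ge0.
  rewrite -(@expr_ge1 _ n _ (ltnW n_gt1) rho0) -[X in X <= _]prodr.
  rewrite -[X in _ ^+ X]card_ord -prodr_const.
  by apply: ler_prod => i _; rewrite cabs_ge0 rl.
split=> //.
(* 1/|l i| is the product of the n-1 other moduli. *)
have lV i : (cabs (l i))^-1 <= rho ^+ n.-1.
  have -> : (cabs (l i))^-1 = \prod_(j | j != i) cabs (l j).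
    apply: (mulfI (lt0r_neq0 (l0 i))); rewrite mulfV ?gt_eqF //.
    by rewrite -[LHS]prodr (bigD1 i).
  rewrite -[n in n.-1]card_ord -(cardC1 i) -prodr_const.
  by apply: ler_prod => j _; rewrite cabs_ge0 rl.
rewrite /unimodularity_defect trl trVl rmorph_sum -sumrB.
apply: le_trans (cabs_sum _ _ _) _.
rewrite mulr_natl -[n in _ *+ n]card_ord -sumr_const.
apply: ler_sum => i _.
have -> : cabs ((l i)^-1 - Num.conj (l i)) = `|(cabs (l i))^-1 - cabs (l i)|.
  have li0 : l i != 0.
    by apply/eqP => li0; move: (l0 i); rewrite li0 /cabs normr0 ltxx.
  have -> : (l i)^-1 - Num.conj (l i) = (1 - (cabs (l i) ^+ 2)%:C) / l i.
    by rewrite cabs_sqr mulrBl mulfK // mul1r.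
  rewrite cabsM cabsV -[1](rmorph1 (real_complex R)) -rmorphB cabs_real.
  rewrite -[in X in _ * X](ger0_norm (cabs_ge0 (l i))) -normfV -normrM.
  by rewrite mulrBl mul1r expr2 mulfK ?gt_eqF.
rewrite mulnC exprM; apply: dist_inv_le => //.
by apply: (le_trans (rl i)); rewrite ler_eXnr // -ltnS prednK // ltnW.
Qed.
End spectral.

(** * Finitely many rotations spanning the matrix algebra *)

Section rotations.
Variables (R : realType) (n : nat).
Implicit Types k l a b p q : 'I_n.

Definition reflection a : 'M[R]_n := diag_mx (\row_i (-1) ^+ (i == a)).

(** The reflection makes the determinant of a transposition equal to one. *)
Definition signed_transposition k l : 'M[R]_n :=
  if k == l then 1%:M else reflection k *m tperm_mx k l.

(** Indices are quadruples ((k, l), (a, b)); for a = b the two reflections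
cancel. *)
Definition rotation (j : 'I_n * 'I_n * ('I_n * 'I_n)) : 'M[R]_n :=
  reflection j.2.1 *m reflection j.2.2 *m signed_transposition j.1.1 j.1.2.

Lemma tr_reflection a : (reflection a)^T = reflection a.
Proof. exact: tr_diag_mx. Qed.

Lemma reflectionK a : reflection a *m reflection a = 1%:M.
Proof.
rewrite mulmx_diag -diag_const_mx; congr diag_mx; apply/rowP => i.
by rewrite !mxE -expr2 sqrr_sign.
Qed.

Lemma det_reflection a : \det (reflection a) = -1.
Proof.
rewrite det_diag (bigD1 a) //= big1 ?mxE ?eqxx ?mulr1 // => i ia.
by rewrite mxE (negbTE ia).
Qed.

Lemma SO_mul (A B : 'M[R]_n) : A *m A^T = 1%:M -> B *m B^T = 1%:M ->
  (A *m B) *m (A *m B)^T = 1%:M.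
Proof. by move=> AA BB; rewrite trmx_mul mulmxA -(mulmxA A B) BB mulmx1. Qed.

Lemma rotation_SO j : SO R n (rotation j).
Proof.
have rr a : reflection a *m (reflection a)^T = 1%:M.
  by rewrite tr_reflection reflectionK.
split.
  apply: SO_mul; first exact: SO_mul.
  rewrite /signed_transposition; case: eqP => _; first by rewrite trmx1 mulmx1.
  apply: SO_mul => //; rewrite tr_tperm_mx -perm_mxM tperm2; exact: perm_mx1.
rewrite !det_mulmx !det_reflection mulrNN !mul1r /signed_transposition.
case: eqP => [_|/eqP kl]; first exact: det1.
by rewrite det_mulmx det_reflection det_perm odd_tperm kl mulrNN mul1r.
Qed.

(** Reflection a is 1 - 2 E_aa, so a product of two distinct reflections is
1 - 2 E_aa - 2 E_bb, and the four terms combine into the single matrix unit.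
Three distinct indices are needed: this is where n >= 3 enters. *)
Lemma reflections_span k p q : k != p -> k != q -> p != q ->
  1%:M + reflection p *m reflection q - reflection k *m reflection p
    - reflection k *m reflection q = 4 *: delta_mx k k.
Proof.
move=> kp kq pq; rewrite !mulmx_diag; apply/matrixP => i j; rewrite !mxE.
have [<-|ij] := eqVneq i j; last first.
  rewrite !mulr0n; have -> : (i == k) && (j == k) = false.
    by apply/negP => /andP[/eqP ik /eqP jk]; rewrite ik jk eqxx in ij.
  by rewrite mulr0 !subr0 addr0.
rewrite andbb; have [->|ik] := eqVneq i k.
  by rewrite (negbTE kp) (negbTE kq) /=; ring.
have [->|ip] := eqVneq i p; first by rewrite (negbTE pq) /=; ring.
by have [_|_] := eqVneq i q; rewrite /=; ring.
Qed.

Lemma delta_signed_transposition k l :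
  delta_mx k k *m signed_transposition k l = (-1) ^+ (k != l) *: delta_mx k l.
Proof.
rewrite /signed_transposition; case: eqP => [<-|_] /=.
  by rewrite mulmx1 expr0 scale1r.
apply/matrixP => i j; rewrite mxE (bigD1 k) //= big1 => [|x xk]; last first.
  by rewrite !mxE (negbTE xk) andbF mul0r.
rewrite mul_diag_mx !mxE !eqxx andbT tpermL addr0.
by have [_|ik] := eqVneq i k; rewrite ?mul1r ?mul0r ?mulr0 // eq_sym.
Qed.

Lemma exists_two_others k : (2 < n)%N -> exists p q, [/\ k != p, k != q & p != q].
Proof.
move=> n3; have : (1 < #|predC1 k|)%N
  by rewrite cardC1 card_ord; case: n n3 => [|[]].
move=> /card_gt1P[p [q]]; rewrite !inE ![_ == k]eq_sym => -[kp kq pq].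
by exists p, q.
Qed.

Definition complexify (A : 'M[R]_n) : 'M[R[i]]_n := map_mx (real_complex R) A.

(** The matrix unit E_kl is, up to sign, a quarter of a signed sum of four
members of the family; the entry D k l is the trace pairing of D with E_kl. *)
Lemma rotations_span (D : 'M[R[i]]_n) k l : (2 < n)%N ->
  cabs (D k l) <= \sum_j cabs (\tr ((complexify (rotation j))^T *m D)).
Proof.
move=> n3; have [p [q [kp kq pq]]] := exists_two_others k n3.
pose f (A : 'M[R]_n) := \tr ((complexify A)^T *m D).
have fD A B : f (A + B) = f A + f B.
  by rewrite /f /complexify map_mxD linearD /= mulmxDl mxtraceD.
have fZ c A : f (c *: A) = c%:C * f A.
  by rewrite /f /complexify map_mxZ linearZ /= -scalemxAl mxtraceZ.
have fN A : f (- A) = - f A by rewrite -scaleN1r fZ rmorphN1 mulN1r.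
have f_delta : f (delta_mx k l) = D k l.
  rewrite /f /complexify map_delta_mx trmx_delta mxtrace_mulC /mxtrace (bigD1 k) //=.
  rewrite mxE (bigD1 l) //= mxE !eqxx mulr1 !big1 ?addr0 // => [x xk|x xl].
    by rewrite mxE big1 // => y _; rewrite !mxE (negbTE xk) andbF mulr0.
  by rewrite !mxE (negbTE xl) mulr0.
have f_le a b : cabs (f (rotation (k, l, (a, b)))) <= \sum_j cabs (f (rotation j)).
  by rewrite (bigD1 (k, l, (a, b))) //= lerDl sumr_ge0 // => j _; exact: cabs_ge0.
have decomp : (4 * (-1) ^+ (k != l)) *: delta_mx k l =
    rotation (k, l, (k, k)) + rotation (k, l, (p, q))
    - rotation (k, l, (k, p)) - rotation (k, l, (k, q)).
  rewrite -scalerA -delta_signed_transposition scalemxAl -(reflections_span kp kq pq).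
  by rewrite /rotation /= reflectionK !mulmxDl !mulNmx.
have : cabs (f ((4 * (-1) ^+ (k != l)) *: delta_mx k l)) <=
    4 * \sum_j cabs (f (rotation j)).
  rewrite decomp !fD !fN.
  apply: le_trans (cabsD _ _) _; rewrite cabsN.
  apply: le_trans (lerD (cabsD _ _) (lexx _)) _; rewrite cabsN.
  apply: le_trans (lerD (lerD (cabsD _ _) (lexx _)) (lexx _)) _.
  move: (f_le k k) (f_le p q) (f_le k p) (f_le k q); lra.
rewrite fZ f_delta cabsM cabs_real normrM normr_sign mulr1 ger0_norm //.
by rewrite ler_pM2l.
Qed.

End rotations.

(** * The operator norm *)

Section norm.
Variables (R : realType) (n : nat).
Implicit Types (X Y : 'M[R[i]]_n) (v w : 'cV[R[i]]_n) (U : 'M[R]_n).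

Lemma l2norm_ge0 (K : numFieldType) (abs : K -> R) (v : 'cV[K]_n) :
  0 <= l2norm abs v.
Proof. exact: sqrtr_ge0. Qed.

Lemma sqr_l2norm v : ((l2norm (@cabs R) v) ^+ 2)%:C = (v^t* *m v) 0 0.
Proof.
rewrite sqr_sqrtr; last by apply: sumr_ge0 => i _; exact: sqr_ge0.
rewrite rmorph_sum mxE; apply: eq_bigr => i _; rewrite !mxE.
exact: cabs_sqr.
Qed.

Lemma cabs_le_l2norm v i : cabs (v i 0) <= l2norm (@cabs R) v.
Proof.
rewrite -[leLHS]ger0_norm ?cabs_ge0 // -sqrtr_sqr ler_wsqrtr // (bigD1 i) //=.
by rewrite lerDl sumr_ge0 // => j _; exact: sqr_ge0.
Qed.

Lemma cabs_form_le (D : 'M[R[i]]_n) v w (d : R) :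
  (forall k l, cabs (D k l) <= d) ->
  cabs ((v^t* *m D *m w) 0 0) <=
    n%:R ^+ 2 * d * l2norm (@cabs R) v * l2norm (@cabs R) w.
Proof.
move=> Dd; set a := l2norm _ v; set b := l2norm _ w.
have a0 : 0 <= a by exact: l2norm_ge0.
have b0 : 0 <= b by exact: l2norm_ge0.
have sum_const (c : R) : n%:R * c = \sum_(i < n) c.
  by rewrite sumr_const card_ord mulr_natl.
have -> : n%:R ^+ 2 * d * a * b = \sum_(j < n) ((\sum_(i < n) a * d) * b).
  by rewrite -!sum_const; ring.
rewrite mxE; apply: le_trans (cabs_sum _ _ _) _.
apply: ler_sum => j _; rewrite cabsM.
apply: ler_pM; rewrite ?cabs_ge0 ?cabs_le_l2norm //.
rewrite mxE; apply: le_trans (cabs_sum _ _ _) _.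
apply: ler_sum => i _; rewrite cabsM.
by apply: ler_pM; rewrite ?cabs_ge0 ?Dd // !mxE cabsJ cabs_le_l2norm.
Qed.

(** Right multiplication by U factors out on the left of both terms:
(XU)^-1 = U^T X^-1 and (XU)^* = U^T X^*. *)
Lemma trace_defect X U : \det X = 1 -> SO R n U ->
  unimodularity_defect (X *m complexify U) =
    cabs (\tr ((complexify U)^T *m (\adj X - X^t*))).
Proof.
move=> dX [UU dU]; rewrite /unimodularity_defect.
set V := complexify U.
have VV : V *m V^T = 1%:M.
  by rewrite /V /complexify map_trmx -map_mxM UU map_mx1.
have dXV : \det (X *m V) = 1 by rewrite det_mulmx dX det_map_mx dU rmorph1 mulr1.
have -> : \adj (X *m V) = V^T *m \adj X.
  have XVI : (X *m V) *m (V^T *m \adj X) = 1%:M.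
    by rewrite mulmxA -(mulmxA X) VV mulmx1 mul_mx_adj dX.
  by rewrite -[LHS]mulmx1 -XVI (mulmxA (\adj (X *m V))) mul_adj_mx dXV mul1mx.
have -> : Num.conj (\tr (X *m V)) = \tr (V^T *m X^t*).
  rewrite -mxtrace_tr trmx_mul -trace_map_mx map_mxM /=.
  congr (\tr (_ *m _)); apply/matrixP => i j; rewrite !mxE.
  exact: conj_real.
by rewrite mulmxBr linearB.
Qed.

(** For unit v and D = X^-1 - X^*, the scalar v^* D X v equals 1 - |Xv|^2, while
the entries of D are controlled by the spanning rotations. *)
Lemma norm_bound X v : (2 < n)%N -> \det X = 1 -> l2norm (@cabs R) v = 1 ->
  l2norm (@cabs R) (X *m v) <=
    1 + n%:R ^+ 2 *
      \sum_j unimodularity_defect (X *m complexify (@rotation R n j)).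
Proof.
move=> n3 dX v1; set w := X *m v; set t := l2norm _ w; set d := \sum_j _.
pose D := \adj X - X^t*.
have dE : d = \sum_j cabs (\tr ((complexify (@rotation R n j))^T *m D)).
  by apply: eq_bigr => j _; rewrite trace_defect //; exact: rotation_SO.
have Dd k l : cabs (D k l) <= d by rewrite dE rotations_span.
have form : (v^t* *m D *m w) 0 0 = (1 - t ^+ 2)%:C.
  have wE : v^t* *m (X^t* *m w) = w^t* *m w.
    by rewrite mulmxA -map_mxM -trmx_mul.
  have DXv : D *m w = v - X^t* *m w.
    by rewrite mulmxBl {1}/w mulmxA mul_adj_mx dX mul1mx.
  rewrite -mulmxA DXv mulmxBr wE mxE [X in _ + X]mxE -!sqr_l2norm v1.
  by rewrite expr1n -rmorphB.
have t0 : 0 <= t by exact: l2norm_ge0.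
have c0 : 0 <= n%:R ^+ 2 * d.
  by rewrite mulr_ge0 ?exprn_ge0 ?ler0n // sumr_ge0 // => j _; exact: cabs_ge0.
have := cabs_form_le v w Dd; rewrite form cabs_real v1 mulr1 -/t => le_t.
have := le_trans (ler_norm _) (eq_ind _ (fun x => x <= _) le_t _ (distrC _ _)).
move: (n%:R ^+ 2 * d) c0 => c c0; nra.
Qed.

End norm.

Section logarithm.
Variables (R : realType) (n : nat).
Hypothesis n3 : (2 < n)%N.

(** A continuous nonnegative minorant of log rho on matrices of determinant one:
the inequality of [defect_le], solved for log rho. *)
Definition log_minorant (Y : 'M[R[i]]_n) : R :=
  ln (1 + unimodularity_defect Y / n%:R) / (2 * n.-1)%:R.

Lemma one_le_defect (Y : 'M[R[i]]_n) : 1 <= 1 + unimodularity_defect Y / n%:R.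
Proof. by rewrite lerDl mulr_ge0 ?invr_ge0 ?ler0n ?cabs_ge0. Qed.

Lemma log_minorant_ge0 Y : 0 <= log_minorant Y.
Proof. by rewrite mulr_ge0 ?invr_ge0 ?ler0n // ln_ge0 // one_le_defect. Qed.

Lemma log_minorant_le Y : \det Y = 1 -> log_minorant Y <= ln (spectral_radiusC Y).
Proof.
move=> dY; have [rho1 le_d] := defect_le (ltnW n3) dY.
have n0 : 0 < n%:R :> R by rewrite ltr0n (ltn_trans _ n3).
have m0 : 0 < (2 * n.-1)%:R :> R by rewrite ltr0n; case: (n) n3 => [|[]].
have rho0 : 0 < spectral_radiusC Y by exact: lt_le_trans rho1.
rewrite ler_pdivrMr // mulr_natr -lnXn //.
have d1 := one_le_defect Y.
rewrite ler_ln ?posrE ?exprn_gt0 ?(lt_le_trans ltr01 d1) //.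
by rewrite -lerBrDl ler_pdivrMr // mulrC.
Qed.

Lemma ln_prod (I : Type) (r : seq I) (F : I -> R) : (forall i, 0 < F i) ->
  ln (\prod_(i <- r) F i) = \sum_(i <- r) ln (F i).
Proof.
move=> F0; elim: r => [|i r IHr]; first by rewrite !big_nil ln1.
by rewrite !big_cons lnM ?IHr ?posrE ?F0 ?prodr_gt0.
Qed.

Lemma one_sum_le_prod (I : Type) (r : seq I) (F : I -> R) : (forall i, 0 <= F i) ->
  1 + \sum_(i <- r) F i <= \prod_(i <- r) (1 + F i).
Proof.
move=> F0; elim: r => [|i r IHr]; first by rewrite !big_nil addr0.
rewrite !big_cons; have s0 : 0 <= \sum_(j <- r) F j by exact: sumr_ge0.
apply: (@le_trans _ _ ((1 + F i) * (1 + \sum_(j <- r) F j))); last first.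
  by rewrite ler_wpM2l // addr_ge0.
have := mulr_ge0 (F0 i) s0; lra.
Qed.

(** Bernoulli's inequality, once in each factor and once across the factors. *)
Lemma ln_one_sum_le (I : finType) (F : I -> R) (N : nat) : (forall i, 0 <= F i) ->
  ln (1 + N%:R * \sum_i F i) <= N%:R * \sum_i ln (1 + F i).
Proof.
move=> F0; have F1 i : 0 < 1 + F i by rewrite ltr_wpDr.
rewrite -ln_prod // [leRHS]mulr_natl -lnXn ?prodr_gt0 // ler_ln ?posrE; last 2 first.
- by rewrite ltr_wpDr // mulr_ge0 ?ler0n ?sumr_ge0.
- by rewrite exprn_gt0 ?prodr_gt0.
rewrite -prodrXl mulr_sumr.
apply: (@le_trans _ _ (\prod_i (1 + N%:R * F i))).
  by apply: one_sum_le_prod => i; rewrite mulr_ge0 ?ler0n.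
apply: ler_prod => i _; rewrite addr_ge0 ?mulr_ge0 ?ler0n //=.
elim: N => [|N IHN]; first by rewrite mul0r addr0.
rewrite exprS; apply: le_trans (ler_wpM2l (ltW (F1 i)) IHN).
rewrite -natr1; have : 0 <= N%:R * F i ^+ 2 by rewrite mulr_ge0 ?ler0n ?sqr_ge0.
lra.
Qed.

Lemma ln_opnorm_le (K : numFieldType) (abs : K -> R) (X : 'M[K]_n) (c : R) :
  1 <= c -> (forall v, l2norm abs v = 1 -> l2norm abs (X *m v) <= c) ->
  ln (opnorm abs X) <= ln c.
Proof.
move=> c1 Xc; have c0 : 0 < c by exact: lt_le_trans c1.
have le_c : opnorm abs X <= c.
  rewrite /opnorm; set E := image _ _.
  have [E0|E0] := pselect (E !=set0).
    by apply: ge_sup => // _ [v v1 <-]; exact: Xc.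
  (* Without unit vectors the supremum takes its default value 0. *)
  by rewrite sup_out ?(ltW c0) // => -[].
have [b0|b0] := leP (opnorm abs X) 0; first by rewrite ln0 // ln_ge0.
by rewrite ler_ln.
Qed.

(** The factor n^3 = n^2 * n turns n^2 g into n^3 (g/n), and 2(n-1) is the
denominator in [log_minorant]. *)
Definition comparison_factor : nat := n ^ 3 * (2 * n.-1).

Lemma ln_bound_le (X : 'M[R[i]]_n) :
  ln (1 + n%:R ^+ 2 *
    \sum_j unimodularity_defect (X *m complexify (@rotation R n j))) <=
  comparison_factor%:R * \sum_j log_minorant (X *m complexify (@rotation R n j)).
Proof.
have n0 : n%:R != 0 :> R by rewrite pnatr_eq0; case: (n) n3.
have m0 : (2 * n.-1)%:R != 0 :> R by rewrite pnatr_eq0; case: (n) n3 => [|[]].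
have -> : n%:R ^+ 2 = (n ^ 3)%:R / n%:R :> R.
  by rewrite natrX; field.
rewrite -mulrA mulr_sumr.
under eq_bigr => j _ do rewrite mulrC.
apply: le_trans (ln_one_sum_le _ _) _ => [j|].
  by rewrite mulr_ge0 ?invr_ge0 ?ler0n ?cabs_ge0.
rewrite /comparison_factor natrM -mulr_suml -mulrA ler_wpM2l ?ler0n //.
by rewrite mulrC divfK.
Qed.

Lemma ln_opnormC_le (X : 'M[R[i]]_n) : \det X = 1 ->
  ln (opnormC X) <= comparison_factor%:R *
    \sum_j log_minorant (X *m complexify (@rotation R n j)).
Proof.
move=> dX; apply: le_trans (ln_bound_le X).
apply: ln_opnorm_le => [|v v1]; last exact: norm_bound.
by rewrite lerDl mulr_ge0 ?sqr_ge0 // sumr_ge0 // => j _; exact: cabs_ge0.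
Qed.

(** A real unit vector is also a complex unit vector, so the complex bound
applies to the complexification of X. *)
Lemma ln_opnormR_le (X : 'M[R]_n) : \det X = 1 ->
  ln (opnormR X) <= comparison_factor%:R *
    \sum_j log_minorant (complexify (X *m rotation R j)).
Proof.
move=> dX; have l2C (v : 'cV[R]_n) :
    l2norm (@cabs R) (map_mx (real_complex R) v) = l2norm (fun x : R => `|x|) v.
  by congr Num.sqrt; apply: eq_bigr => i _; rewrite mxE cabs_real.
under eq_bigr => j _ do rewrite /complexify map_mxM.
apply: le_trans (ln_bound_le _).
apply: ln_opnorm_le => [|v v1].
  by rewrite lerDl mulr_ge0 ?sqr_ge0 // sumr_ge0 // => j _; exact: cabs_ge0.
by rewrite -l2C map_mxM; apply: norm_bound; rewrite // ?l2C ?det_map_mx ?dX ?rmorph1.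
Qed.

End logarithm.

(** * Measurability and integration *)

Section matrix_continuity.
Variables (K : numFieldType).

Lemma continuous_mulr (T : topologicalType) (f g : T -> K) :
  continuous f -> continuous g -> continuous (fun x => f x * g x).
Proof. by move=> cf cg x; apply: cvgM; [exact: cf|exact: cg]. Qed.

Lemma continuous_det (T : topologicalType) m (F : T -> 'M[K]_m) :
  (forall i j, continuous (fun x => F x i j)) -> continuous (fun x => \det (F x)).
Proof.
move=> cF; apply: (@continuous_big K _ +%R 0 _ add_continuous) => s _ x.
apply: cvgM; first exact: cvg_cst.
apply: (@continuous_big K _ *%R 1 _ mul_continuous) => i _; exact: cF.
Qed.


Lemma continuous_mul_coord n (U : 'M[K]_n) i j :
  continuous (fun X : 'M[K]_n => (X *m U) i j).
Proof.
have -> : (fun X : 'M[K]_n => (X *m U) i j) = (fun X => \sum_k X i k * U k j).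
  by apply/funext => X; rewrite mxE.
apply: (@continuous_big K _ +%R 0 _ add_continuous) => k _.
apply: continuous_mulr; last exact: cst_continuous.
exact: coord_continuous.
Qed.

Lemma continuous_tr (T : topologicalType) m (F : T -> 'M[K]_m) :
  (forall i j, continuous (fun x => F x i j)) -> continuous (fun x => \tr (F x)).
Proof.
by move=> cF; apply: (@continuous_big K _ +%R 0 _ add_continuous) => i _; exact: cF.
Qed.

Lemma continuous_adj_coord (T : topologicalType) m (F : T -> 'M[K]_m) i j :
  (forall i j, continuous (fun x => F x i j)) -> continuous (fun x => \adj (F x) i j).
Proof.
move=> cF; have -> : (fun x => \adj (F x) i j) = (fun x => cofactor (F x) j i).
  by apply/funext => x; rewrite mxE.
apply: continuous_mulr; first exact: cst_continuous.
apply: continuous_det => k l.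
have -> : (fun x => row' j (col' i (F x)) k l) = (fun x => F x (lift j k) (lift i l)).
  by apply/funext => y; rewrite !mxE.
exact: cF.
Qed.

End matrix_continuity.

Section borel.
Variables (R : realType) (K : numFieldType) (n : nat).

Lemma open_measurable_mx (A : set 'M[K]_n) :
  open A -> measurable (A : set (borel_mx K n)).
Proof. by move=> oA; exact: sub_sigma_algebra. Qed.

Lemma continuous_measurable_mx (f : 'M[K]_n -> R) :
  continuous f -> measurable_fun setT (f : borel_mx K n -> R).
Proof.
move=> cf; apply: (measurability _ (RGenOpens.measurableE R)).
move=> _ [_ [a [b ->] <-]]; rewrite setTI; apply: open_measurable_mx.
by apply: open_comp => [x _|]; [exact: cf | exact: interval_open].
Qed.

Lemma measurable_SL : measurable (SL K n).
Proof.
rewrite -[X in measurable X]setCK; apply: measurableC; apply: open_measurable_mx.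
rewrite openC; apply: (@preimage_closed _ _ (fun X : 'M[K]_n => \det X) [set 1]).
  by move=> x _; apply: continuous_det => i j; exact: coord_continuous.
apply: accessible_closed_set1; apply: hausdorff_accessible; exact: norm_hausdorff.
Qed.

Lemma measurable_GL : measurable (GL K n).
Proof.
apply: open_measurable_mx.
have -> : GL K n = ~` ((fun X : 'M[K]_n => \det X) @^-1` [set 0]).
  apply/seteqP; split=> X; rewrite /GL /= unitmxE unitfE; first by move/eqP.
  by move=> ?; exact/eqP.
rewrite openC; apply: preimage_closed.
  by move=> x _; apply: continuous_det => i j; exact: coord_continuous.
apply: accessible_closed_set1; apply: hausdorff_accessible; exact: norm_hausdorff.
Qed.
End borel.

Section integral_comparison.
Local Open Scope ereal_scope.

(** The integral of a nonnegative function is a supremum over simple functions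
below it, hence monotone with no measurability assumption. It is applied with
g = log rho. *)
Lemma le_integral_nonneg d (T : measurableType d) (R : realType)
    (mu : {measure set T -> \bar R}) (D : set T) (f g : T -> \bar R) :
  (forall x, D x -> 0 <= f x) -> (forall x, D x -> f x <= g x) ->
  \int[mu]_(x in D) f x <= \int[mu]_(x in D) g x.
Proof.
move=> f0 fg; rewrite [leLHS]integral_mkcond [leRHS]integral_mkcond.
have fg' x : (f \_ D) x <= (g \_ D) x by exact: lee_restrict.
have f0' x : 0 <= (f \_ D) x by exact: erestrict_ge0.
rewrite !ge0_integralTE //; last by move=> x; exact: le_trans (fg' x).
apply: le_ereal_sup => _ [h /= hf <-]; exists h => // x.
exact: le_trans (fg' x).
Qed.

(** The averaging step: L plays the role of log ||X||, r that of log rho, and h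
is the measurable function squeezed between them along the family U. *)
Lemma integral_comparison (R : realType) (K : numFieldType) n
    (mu : {measure set (borel_mx K n) -> \bar R}) (G : set 'M[K]_n)
    (J : finType) (U : J -> 'M[K]_n) (h L r : 'M[K]_n -> R) (c : nat) :
  measure_on_SL mu -> right_invariant G mu -> (forall j, G (U j)) ->
  (forall j, measurable_fun setT
    (fun X : borel_mx K n => h ((X : 'M[K]_n) *m U j))) ->
  measurable_fun setT (h : borel_mx K n -> R) ->
  (forall X, (0 <= h X)%R) ->
  (forall X, \det X = 1%R -> (h X <= r X)%R) ->
  (forall X, \det X = 1%R -> (L X <= c%:R * \sum_j h (X *m U j))%R) ->
  mu.-integrable (SL K n) (fun X => (L X)%:E) ->
  \int[mu]_(X in SL K n) (L X)%:E <=
    (c * #|J|)%:R%:E * \int[mu]_(X in SL K n) (r X)%:E.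
Proof.
move=> muSL inv GU mhU mh h0 hr Lh intL.
have mSL := @measurable_SL K n.
have GL_SL (f : 'M[K]_n -> R) : measurable_fun setT (f : borel_mx K n -> R) ->
    (forall X, 0 <= f X)%R ->
    \int[mu]_(X in GL K n) (f X)%:E = \int[mu]_(X in SL K n) (f X)%:E.
  move=> mf f0; rewrite (@ge0_negligible_integral _ _ _ mu _ (~` SL K n)) //.
  - congr integral; apply/seteqP; split=> X /=.
      by move=> [_ /contrapT].
    by move=> SX; split => //; rewrite /GL /= unitmxE SX unitr1.
  - exact: measurableC.
  - exact: measurable_GL.
  - by apply/measurable_EFinP; exact: measurable_funTS.
  - by move=> X _; rewrite lee_fin.
have inv_h j : \int[mu]_(X in SL K n) (h ((X : 'M[K]_n) *m U j))%:E =
    \int[mu]_(X in SL K n) (h X)%:E.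
  rewrite -(GL_SL (fun X => h (X *m U j))) // -GL_SL //.
  by apply: inv => //; exact: measurable_funTS.
have mhE j : measurable_fun (SL K n) (fun X => (h ((X : 'M[K]_n) *m U j))%:E).
  by apply/measurable_EFinP; exact: measurable_funTS.
have cE : forall X : 'M[K]_n, (c%:R * \sum_j h (X *m U j))%:E =
    c%:R%:E * \sum_j (h (X *m U j))%:E.
  by move=> X; rewrite EFinM sumEFin.
apply: (@le_trans _ _
  (\int[mu]_(X in SL K n) (c%:R * \sum_j h ((X : 'M[K]_n) *m U j))%:E)).
  (* L may be negative somewhere; its positive part is still below the sum. *)
  rewrite integralE.
  apply: (@le_trans _ _ (\int[mu]_(X in SL K n) ((fun X => (L X)%:E)^\+ X))).
    by rewrite -[leRHS]sube0 leeB // integral_ge0 // => X _; exact: funeneg_ge0.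
  apply: le_integral_nonneg => X SX //.
  rewrite funeposE ge_max !lee_fin Lh //=.
  by rewrite mulr_ge0 ?ler0n // sumr_ge0.
under eq_integral do rewrite cE.
rewrite ge0_integralZl_EFin //; last 2 first.
- by move=> X _; apply: sume_ge0 => j _; rewrite lee_fin.
- by apply: emeasurable_sum => j; exact: mhE.
rewrite ge0_integral_sum //; last by move=> j X _; rewrite lee_fin.
under eq_bigr do rewrite inv_h.
have -> (x : \bar R) : \sum_(j : J) x = #|J|%:R%:E * x.
  rewrite -[in LHS](mul1e x).
  by rewrite -ge0_sume_distrl // sumEFin sumr_const.
rewrite muleA -EFinM -natrM; apply: lee_wpmul2l; first by rewrite lee_fin ler0n.
apply: le_integral_nonneg => X SX; first by rewrite lee_fin.
by rewrite lee_fin hr.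
Qed.
End integral_comparison.

Section defect_measurability.
Variables (R : realType) (n : nat).

(** Uniform continuity of phi is stated with the radius in K and the error in R,
because phi goes from R[i] to R in the complex case. *)
Lemma continuous_pairing (K : numFieldType) (T : topologicalType)
    (phi : K -> K -> R) (f g : T -> K) :
  (forall e : R, 0 < e -> exists2 d : K, 0 < d &
    forall a b a' b', `|a - a'| < d -> `|b - b'| < d ->
      `|phi a b - phi a' b'| < e) ->
  continuous f -> continuous g -> continuous (fun x => phi (f x) (g x)).
Proof.
move=> phi_uc cf cg x; apply/cvgrPdist_lt => e /phi_uc[d d0 phid].
have /cvgrPdist_lt/(_ d d0) near_f := cf x.
have /cvgrPdist_lt/(_ d d0) near_g := cg x.
by apply: filterS2 near_f near_g => y; exact: phid.
Qed.

Lemma continuous_trace_pairing (K : numFieldType) (phi : K -> K -> R) (U : 'M[K]_n) :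
  (forall e : R, 0 < e -> exists2 d : K, 0 < d &
    forall a b a' b', `|a - a'| < d -> `|b - b'| < d ->
      `|phi a b - phi a' b'| < e) ->
  continuous (fun X : 'M[K]_n => phi (\tr (\adj (X *m U))) (\tr (X *m U))).
Proof.
move=> phi_uc; have cU i j : continuous (fun X : 'M[K]_n => (X *m U) i j).
  exact: continuous_mul_coord.
apply: (continuous_pairing phi_uc); last exact: continuous_tr.
by apply: continuous_tr => i j; exact: continuous_adj_coord.
Qed.

Lemma measurable_log_minorant (K : numFieldType) (F : 'M[K]_n -> 'M[R[i]]_n) :
  continuous (fun X : 'M[K]_n => unimodularity_defect (F X)) ->
  measurable_fun setT ((fun X => log_minorant (F X)) : borel_mx K n -> R).
Proof.
move=> /continuous_measurable_mx mF; rewrite /log_minorant.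
apply: measurable_funM; last exact: measurable_cst.
apply: measurableT_comp; first exact: measurable_ln.
apply: measurable_funD; first exact: measurable_cst.
by apply: measurable_funM => //; exact: measurable_cst.
Qed.

Lemma measurable_log_minorantR (U : 'M[R]_n) :
  measurable_fun setT
    ((fun X => log_minorant (complexify ((X : 'M[R]_n) *m U)))
      : borel_mx R n -> R).
Proof.
apply: (@measurable_log_minorant R (fun X => complexify (X *m U))).
have -> : (fun X : 'M[R]_n => unimodularity_defect (complexify (X *m U))) =
    (fun X => `|\tr (\adj (X *m U)) - \tr (X *m U)|).
  apply/funext => X; rewrite /unimodularity_defect /complexify -map_mx_adj.
  rewrite !trace_map_mx.
  by rewrite conj_real -rmorphB cabs_real.
apply: (@continuous_trace_pairing R (fun a b => `|a - b|)) => e e0.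
exists (e / 2); first by rewrite divr_gt0.
move=> a b a' b' aa bb; apply: le_lt_trans (ler_dist_dist _ _) _.
have -> : a - b - (a' - b') = (a - a') - (b - b') by ring.
by apply: le_lt_trans (ler_normB _ _) _; rewrite [ltRHS](splitr e) ltrD.
Qed.

Lemma measurable_log_minorantC (U : 'M[R[i]]_n) :
  measurable_fun setT
    ((fun X => log_minorant ((X : 'M[R[i]]_n) *m U)) : borel_mx R[i] n -> R).
Proof.
apply: (@measurable_log_minorant _ (fun X => X *m U)).
apply: (@continuous_trace_pairing _ (fun a b => cabs (a - Num.conj b))) => e e0.
exists (e / 2)%:C; first by rewrite ltcR divr_gt0.
have lt_cabs (z : R[i]) r : (`|z| < r%:C) = (cabs z < r) by rewrite -cabsE ltcR.
move=> a b a' b'; rewrite !lt_cabs => aa bb.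
have cabs_dist (z w : R[i]) : `|cabs z - cabs w| <= cabs (z - w).
  have aux u v : cabs u - cabs v <= cabs (u - v).
    by rewrite lerBlDr -{1}(subrK v u) cabsD.
  by rewrite ler_norml lerNl opprB aux -(cabsN (z - w)) opprB aux.
apply: le_lt_trans (cabs_dist _ _) _.
have -> : a - Num.conj b - (a' - Num.conj b') = (a - a') - Num.conj (b - b').
  by rewrite rmorphB /=; ring.
apply: le_lt_trans (cabsD _ _) _.
by rewrite cabsN cabsJ [ltRHS](splitr e) ltrD.
Qed.
End defect_measurability.

Theorem corollary5 (R : realType) (n : nat) (hn : (3 <= n)%N) :
  (exists C : R, 0 < C /\
    forall mu : {measure set (borel_mx R n) -> \bar R},
      measure_on_SL mu -> orthogonally_invariant mu ->
      mu.-integrable (SL R n) (fun X => (ln (opnormR X))%:E) ->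
      (C%:E * \int[mu]_(X in SL R n) (ln (opnormR X))%:E <=
       \int[mu]_(X in SL R n) (ln (spectral_radiusR X))%:E)%E) /\
  (exists C' : R, 0 < C' /\
    forall mu : {measure set (borel_mx R[i] n) -> \bar R},
      measure_on_SL mu -> unitarily_invariant mu ->
      mu.-integrable (SL R[i] n) (fun X => (ln (opnormC X))%:E) ->
      (C'%:E * \int[mu]_(X in SL R[i] n) (ln (opnormC X))%:E <=
       \int[mu]_(X in SL R[i] n) (ln (spectral_radiusC X))%:E)%E).
Proof.
pose J : finType := ('I_n * 'I_n * ('I_n * 'I_n))%type.
have N0 : 0 < (comparison_factor n * #|J|)%:R :> R.
  rewrite ltr0n muln_gt0 /comparison_factor !card_prod card_ord.
  by case: (n) hn => [|[]].
have gt0 := N0; rewrite -invr_gt0 in gt0.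
have det_map (X : 'M[R]_n) : \det X = 1 -> \det (complexify X) = 1.
  by move=> dX; rewrite det_map_mx dX rmorph1.
split; exists (comparison_factor n * #|J|)%:R^-1; split=> // mu muSL inv int_norm;
  rewrite lee_pdivrMl //.
- apply: (integral_comparison (U := @rotation R n)
    (h := fun X => log_minorant (complexify X)) muSL inv) int_norm
    => [j|j||X|X dX|X dX].
  + exact: rotation_SO.
  + exact: measurable_log_minorantR.
  + have := measurable_log_minorantR (1%:M : 'M[R]_n).
    by under eq_fun do rewrite mulmx1.
  + exact: log_minorant_ge0.
  + by apply: log_minorant_le => //; exact: det_map.
  + exact: ln_opnormR_le.
- apply: (integral_comparison (U := fun j => complexify (@rotation R n j))
    (h := @log_minorant R n) muSL inv) int_norm => [j|j||X|X dX|X dX].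
  + have [UU dU] := rotation_SO R j.
    split; last exact: det_map.
    rewrite qualifE /=; apply/eqP.
    rewrite -[RHS](map_mx1 (real_complex R)) -UU map_mxM.
    congr (_ *m _); apply/matrixP => k l; rewrite !mxE; exact: conj_real.
  + exact: measurable_log_minorantC.
  + have := measurable_log_minorantC (1%:M : 'M[R[i]]_n).
    by under eq_fun do rewrite mulmx1.
  + exact: log_minorant_ge0.
  + exact: log_minorant_le.
  + exact: ln_opnormC_le.
Qed.
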